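(* Let $(X,T)$ be a topological dynamical system. If there exists a subsequence $A$ of $\mathbb{N}$ with $\bar{D}(A)>0$ such that $(X,T)$ is $A$-mean-equicontinuous, then the topological entropy of $(X,T)$ is zero.
   Context: A topological dynamical system $(X,T)$ is a non-empty compact metric space $X$ with metric $d$ together with a homeomorphism $T:X\to X$. $\mathbb{N}=\{0,1,2,\dots\}$. A subsequence $A=\{a_i:i\in\mathbb{N}\}$ of $\mathbb{N}$ is an infinite set of natural numbers listed in strictly increasing order $a_0<a_1<\cdots$. Its upper density is $\bar{D}(A)=\limsup_{n\to\infty}\frac{|A\cap[0,n-1]|}{n}$. For $x,y\in X$ and $n\geq1$ let $\bar{d}_n^A(x,y)=\frac1n\sum_{i=0}^{n-1}d(T^{a_i}x,T^{a_i}y)$. $(X,T)$ is $A$-mean-equicontinuous if for every $\epsilon>0$ there is $\delta>0$ such that for all $x,y\in X$ with $d(x,y)<\delta$ one has $\limsup_{n\to\infty}\bar{d}_n^A(x,y)<\epsilon$. *)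

(* Defs.v *)
From HB Require Import structures.
From mathcomp Require Export all_boot all_order all_algebra finmap.
From mathcomp Require Export all_classical all_reals all_analysis.

Set Implicit Arguments.
Unset Strict Implicit.
Unset Printing Implicit Defensive.

Export Order.TTheory GRing.Theory Num.Theory numFieldNormedType.Exports.

Local Open Scope classical_set_scope.
Local Open Scope ring_scope.

Definition homeomorphism (X : topologicalType) (T : X -> X) : Prop :=
  continuous T /\
  exists2 S : X -> X, continuous S & cancel T S /\ cancel S T.

(* A compact metric space X is encoded as a metricType whose full set is
   compact; a metricType may be empty, hence the nonemptiness clause. *)
Definition topological_dynamical_system (R : realType) (X : metricType R)
    (T : X -> X) : Prop :=
  [/\ [set: X] !=set0, compact [set: X] & homeomorphism T].

(* A subsequence A of the natural numbers is given by its increasing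
   enumeration a; the underlying set is range a. *)
Definition subsequence (a : nat -> nat) : Prop :=
  {homo a : i j / (i < j)%N >-> (i < j)%N}.

Definition upper_density (R : realType) (A : set nat) : \bar R :=
  limn_esup (fun n : nat =>
    (#|[pred i : 'I_n | (i : nat) \in A]|%:R / n%:R : R)%:E).

Definition mean_dist (R : realType) (X : metricType R) (T : X -> X)
    (a : nat -> nat) (n : nat) (x y : X) : R :=
  n%:R^-1 * \sum_(i < n) mdist (iter (a i) T x) (iter (a i) T y).

Definition mean_equicontinuous (R : realType) (X : metricType R) (T : X -> X)
    (a : nat -> nat) : Prop :=
  forall e : R, 0 < e -> exists2 delta : R, 0 < delta &
    forall x y : X, mdist x y < delta ->
      (limn_esup (fun n : nat => (mean_dist T a n x y)%:E) < e%:E)%E.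

(* Topological entropy following Bowen:
   h(T) = lim_(e -> 0+) limsup_n (1/n) log s_n(e),
   with s_n(e) the maximal cardinality of an (n, e)-separated set. *)
Definition bowen_dist (R : realType) (X : metricType R) (T : X -> X)
    (n : nat) (x y : X) : R :=
  \big[Num.max/0]_(i < n) mdist (iter i T x) (iter i T y).

Definition separated (R : realType) (X : metricType R) (T : X -> X)
    (n : nat) (e : R) (E : {fset X}) : Prop :=
  forall x y : X, x \in E -> y \in E -> x != y ->
    e < bowen_dist T n x y.

Definition separated_card (R : realType) (X : metricType R) (T : X -> X)
    (n : nat) (e : R) : \bar R :=
  ereal_sup
    [set (#|` E|%:R : R)%:E | E in [set E : {fset X} | separated T n e E]].

Definition entropy_at_scale (R : realType) (X : metricType R) (T : X -> X)
    (e : R) : \bar R :=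
  limn_esup (fun n : nat => ((n%:R^-1)%:E * lne (separated_card T n e))%E).

Definition topological_entropy (R : realType) (X : metricType R)
    (T : X -> X) : \bar R :=
  lim (entropy_at_scale T e @[e --> 0^'+]).

(* Main.v *)
From HB Require Import structures.
Require Import Defs.
From mathcomp Require Import ring lra.

(** The proof is a covering argument that avoids invariant measures.

    Fix a scale rho, and say that lam is an admissible growth rate if X is
    covered, for every n, by at most C * expR (lam * n) cylinders of length n,
    a cylinder being the set of points that stay rho-close to a prescribed word
    of n points. Compactness gives an admissible lam, and if arbitrarily small
    positive rates are admissible at every scale then the entropy is zero, because
    an (n, 2 * rho)-separated set has at most one point in each cylinder
    (separated_card_growth).

    Let alpha > 0 be such that the range A of the subsequence has density at least
    alpha in arbitrarily long windows [0, n). The key step, growth_contraction,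
    shows that if lam is admissible then so is lam * (1 - alpha) + 3 * eta for
    every eta > 0; therefore the infimum of the admissible rates is zero. It rests
    on two ideas.

    First, if y is close to c at most of the times in A, then the orbit of y has to
    be encoded only at the times outside A, a fraction 1 - alpha of them. A naive
    encoding of those times could be expensive, as they may be scattered. But by
    continuity, closeness at one time of A persists for m further steps. So one
    encodes y gap by gap: each gap of A costs C * expR (lam * length), and, apart
    from the few times of A at which y is far from c, it is followed by m steps
    that cost nothing. There are thus few gaps, and the constants C contribute a
    negligible exponent when m is large (covered_few_bad_times).

    Second, mean equicontinuity says that every y close to c is eventually close in
    mean to c along A, but from a time N that depends on y. One thus has to cut X
    into countably many pieces, each with a good covering at one length n only.
    Covering numbers are not countably stable, but Bowen's weighted sums
    of expR (- lam * length) over words of various lengths are; and, for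
    the whole compact space, a finite cover of weight at most 1 can be concatenated
    with itself to bound all covering numbers (growth_of_weighted_cover,
    growth_of_countable_cover). *)

Set Implicit Arguments.
Unset Strict Implicit.
Unset Printing Implicit Defensive.

Local Open Scope classical_set_scope.
Local Open Scope ring_scope.

(** * Upper limits, exponentials and compactness *)

Lemma limn_esup_le (R : realType) (u : nat -> \bar R) (l : \bar R) N :
  (forall n, (N <= n)%N -> (u n <= l)%E) -> (limn_esup u <= l)%E.
Proof.
move=> ul; apply: (@le_trans _ _ (ereal_sup (u @` [set n | (N <= n)%N]))).
  by apply: ereal_inf_lbound; exists [set n | (N <= n)%N] => //; exists N.
by apply: ge_ereal_sup => _ /= [n Nn <-]; exact: ul.
Qed.

Lemma limn_esup_lt (R : realType) (u : nat -> \bar R) (l : \bar R) :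
  (limn_esup u < l)%E -> exists N, forall n, (N <= n)%N -> (u n < l)%E.
Proof.
move=> /ereal_inf_lt[_ [S [N _ NS] <-] Sl]; exists N => n Nn.
by apply: le_lt_trans Sl; apply: ereal_sup_ubound; exists n => //; exact: NS.
Qed.

Lemma exists_expR_ge (R : realType) (b x : R) : 0 < b ->
  exists2 n : nat, (0 < n)%N & forall m, (n <= m)%N -> x <= expR (b * m%:R).
Proof.
move=> b0; exists (Num.truncn (x / b)).+1 => // m nm.
apply: le_trans (expR_ge1Dx _); rewrite ler_wpDl// mulrC -ler_pdivrMr//.
by apply: ltW; rewrite (lt_le_trans (truncnS_gt _))// ler_nat.
Qed.

Lemma compact_finite_subcover (Y : topologicalType) (I : choiceType)
    (f : I -> set Y) :
  compact [set: Y] -> (forall i, open (f i)) -> (forall y, exists i, f i y) ->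
  exists D : seq I, forall y, exists2 i, i \in D & f i y.
Proof.
move=> cY fo fY.
have [[y0 _]|Y0] := pselect (exists y : Y, True); last first.
  by exists [::] => y; case: Y0; exists y.
(* The open-cover form of compactness is stated for pointed spaces. *)
pose Y' : ptopologicalType := HB.pack Y (isPointed.Build Y y0).
have : cover_compact [set: Y'] by rewrite -compact_cover.
move=> /(_ I setT f)[||D _ DY]; first by move=> i _; exact: fo.
  by move=> y _; have [i fiy] := fY y; exists i.
by exists (D : seq I) => y; have [i /= iD iy] := DY y Logic.I; exists i.
Qed.

(** * Windows of a set of natural numbers *)

Lemma count_iotaD (P : pred nat) m l :
  count P (iota 0 (m + l)) =
  (count P (iota 0 m) + count (fun j => P (m + j)%N) (iota 0 l))%N.
Proof.
by rewrite iotaD count_cat add0n -{2}(addn0 m) iotaDl count_map.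
Qed.

Lemma card_ord_count (P : pred nat) n :
  #|[pred i : 'I_n | P i]| = count P (iota 0 n).
Proof.
rewrite -val_enum_ord count_map cardE -size_filter; congr size.
by rewrite enumT; apply: eq_filter.
Qed.

(** Identifies averages along the enumeration a with sums over the set range a
    restricted to an initial window. *)
Lemma subsequence_filter (a : nat -> nat) n : subsequence a ->
  exists k, [seq j <- iota 0 n | j \in range a] = map a (iota 0 k).
Proof.
move=> amono.
have amono' i j : (a i < a j)%N = (i < j)%N.
  exact: (leqW_mono (leq_mono amono)).
have ai i : (i <= a i)%N.
  by elim: i => // i IH; exact: leq_ltn_trans IH (amono _ _ (ltnSn i)).
have [k ak kmin] := @ex_minnP (fun k => n <= a k)%N (ex_intro _ n (ai n)).
(* k is the first index with n <= a k. *)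
exists k; apply: (irr_sorted_eq ltn_trans ltnn).
- by rewrite sorted_filter ?iota_ltn_sorted//; exact: ltn_trans.
- by rewrite sorted_map (eq_sorted (e' := ltn)) ?iota_ltn_sorted// => i j /=.
move=> j; rewrite mem_filter mem_iota /= add0n.
apply/idP/mapP => [/andP[/set_mem[i _ <-] ain]|[i]].
  exists i => //; rewrite mem_iota/= add0n -amono'.
  exact: leq_trans ak.
rewrite mem_iota/= add0n => ik ->; rewrite mem_set/=; last by exists i.
by rewrite ltnNge; apply: contraL ik => /kmin; rewrite -leqNgt.
Qed.

(** Only a fixed density along infinitely many windows is available, so every
    later estimate must work with windows chosen freely among arbitrarily long
    ones. *)
Lemma density_of_upper_density_gt0 (R : realType) (A : set nat) :
  (0 < upper_density R A)%E ->
  exists2 alpha : R, 0 < alpha & forall N, exists2 n, (N <= n)%N &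
    alpha * n%:R <= (count (fun j => j \in A) (iota 0 n))%:R.
Proof.
move=> D0; apply: contrapT => H; move: D0; apply/negP; rewrite -leNgt.
apply/lee_addgt0Pr => e e0; rewrite add0e.
have [N HN] : exists N, forall n, (N <= n)%N ->
    (count (fun j => j \in A) (iota 0 n))%:R < e * n%:R.
  apply: contrapT => HN; apply: H; exists e => // N.
  apply: contrapT => Hn; apply: HN; exists N => n Nn; rewrite ltNge.
  by apply/negP => h; apply: Hn; exists n.
apply: (@limn_esup_le _ _ _ N) => n Nn; rewrite lee_fin card_ord_count.
have := HN _ Nn; case: n Nn => [|n] Nn h; first by rewrite invr0 mulr0 ltW.
by rewrite ler_pdivrMr// ltW.
Qed.

Section Cylinders.
Context {R : realType} {X : metricType R}.
Variable T : X -> X.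

(** * Coverings by cylinders of pseudo-orbits *)

(** The cylinder of the pseudo-orbit w. Arbitrary words are allowed, not only
    orbit segments, so that any two words may be concatenated; Bowen balls,
    which are the cylinders of orbit segments, lack this property. *)
Fixpoint follows (rho : R) (w : seq X) (y : X) : bool :=
  if w is p :: w' then (mdist p y < rho) && follows rho w' (T y) else true.

Lemma follows_cat rho u v y :
  follows rho (u ++ v) y = follows rho u y && follows rho v (iter (size u) T y).
Proof. by elim: u y => //= p u IH y; rewrite IH andbA -iterSr. Qed.

Lemma follows_take rho n w y : follows rho w y -> follows rho (take n w) y.
Proof. by rewrite -{1}(cat_take_drop n w) follows_cat => /andP[]. Qed.

Lemma follows_dist rho w y z i : follows rho w y -> follows rho w z ->
  (i < size w)%N -> mdist (iter i T y) (iter i T z) < rho + rho.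
Proof.
elim: w y z i => //= p w IH y z [|i] /andP[py wy] /andP[pz wz] iw.
  by rewrite (le_lt_trans (metric_triangle y p z))// ltrD// metric_sym.
by rewrite !iterSr; apply: IH.
Qed.

Lemma follows_traject rho y z m :
  (forall j, (j < m)%N -> mdist (iter j T z) (iter j T y) < rho) ->
  follows rho (traject T z m) y.
Proof.
elim: m y z => //= m IH y z h; rewrite (h 0%N)//=.
by apply: IH => j jm; rewrite -!iterSr; exact: h.
Qed.

Lemma open_follows rho w : continuous T -> open [set y | follows rho w y].
Proof.
move=> cT; elim: w => [|p w IH] /=.
  by rewrite (_ : [set y | _] = setT); [exact: openT|apply/seteqP; split].
rewrite (_ : [set y | _] = [set y | mdist p y < rho] `&`
   T @^-1` [set y | follows rho w y]); last first.
  by apply/seteqP; split => y /= => [/andP[]//|[-> ->]].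
apply: openI; last by apply: open_comp => // x _; exact: cT.
rewrite openE => y /= pyr.
apply/metricType_numDomainType.nbhs_mdistP.
exists (rho - mdist p y); first by rewrite /= subr_gt0.
by move=> z /=; rewrite ltrBrDl; apply: le_lt_trans; exact: metric_triangle.
Qed.

Definition covered (rho : R) (S : set X) (n : nat) (k : R) : Prop :=
  exists F : seq (seq X),
    [/\ all (fun w => size w == n) F, (size F)%:R <= k
      & forall y, S y -> has (follows rho ^~ y) F].

Lemma covered_le rho (S S' : set X) n k k' :
  S' `<=` S -> k <= k' -> covered rho S n k -> covered rho S' n k'.
Proof.
move=> SS kk [F [Fn Fk FS]]; exists F; split => // [|y /SS/FS//].
exact: le_trans kk.
Qed.

Lemma covered0 rho n : covered rho set0 n 0.
Proof. by exists [::]; split. Qed.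

Lemma coveredT0 rho S : covered rho S 0 1.
Proof. by exists [:: [::]]; split. Qed.

Lemma coveredU rho S1 S2 n k1 k2 : covered rho S1 n k1 -> covered rho S2 n k2 ->
  covered rho (S1 `|` S2) n (k1 + k2).
Proof.
move=> [F1 [n1 c1 s1]] [F2 [n2 c2 s2]]; exists (F1 ++ F2); split.
- by rewrite all_cat n1.
- by rewrite size_cat natrD lerD.
- by move=> y [/s1|/s2] h; rewrite has_cat h ?orbT.
Qed.

Lemma covered_cat rho S1 S2 m n k1 k2 :
  covered rho S1 m k1 -> covered rho S2 n k2 ->
  covered rho (S1 `&` iter m T @^-1` S2) (m + n) (k1 * k2).
Proof.
move=> [F1 [/allP n1 c1 s1]] [F2 [/allP n2 c2 s2]].
exists [seq u ++ v | u <- F1, v <- F2]; split.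
- apply/allP => _ /allpairsP[[u v] /= [/n1/eqP uF /n2/eqP vF ->]].
  by rewrite size_cat uF vF.
- by rewrite size_allpairs natrM ler_pM.
- move=> y [/s1/hasP[u uF uy] /s2/hasP[v vF vy]]; apply/hasP.
  exists (u ++ v); first by apply/allpairsP; exists (u, v).
  by rewrite follows_cat uy (eqP (n1 _ uF)).
Qed.

(** * Growth rates and weighted covers *)

(** The infimum of the rates lam with this property is the topological entropy
    of T at scale rho, in terms of covers instead of separated sets. *)
Definition growth (rho lam : R) : Prop :=
  exists2 C : R, 1 <= C &
    forall n, covered rho setT n (C * expR (lam * n%:R)).

Lemma growth_le rho lam lam' : lam <= lam' -> growth rho lam -> growth rho lam'.
Proof.
move=> ll [C C1 h]; exists C => // n; apply: covered_le (h n) => //.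
by rewrite ler_pM2l ?ler_expR ?ler_wpM2r// (lt_le_trans _ C1).
Qed.

(** The Caratheodory sum used in Bowen's dimension-like definition of entropy. *)
Definition weight (lam : R) (W : seq (seq X)) : R :=
  \sum_(w <- W) expR (- (lam * (size w)%:R)).

Lemma weight_extend lam n (W F : seq (seq X)) : weight lam W <= 1 ->
  weight lam (flatten [seq if size w == n then [seq w ++ v | v <- W] else [:: w]
                      | w <- F]) <= weight lam F.
Proof.
move=> W1; rewrite /weight big_flatten /= big_map ler_sum// => w _.
(* Extending one word by all of W multiplies its weight by weight lam W. *)
case: ifP => _; last by rewrite big_seq1.
rewrite big_map (eq_bigr (fun v => expR (- (lam * (size w)%:R)) *
   expR (- (lam * (size v)%:R)))); last first.
  by move=> v _; rewrite size_cat natrD mulrDr opprD expRD.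
by rewrite -mulr_sumr ler_piMr ?expR_ge0.
Qed.

(** Bowen's argument that the dimension-like entropy of the whole space bounds
    its covering growth: a word of the cover may be continued by the cover again,
    since the cover applies at every point of the orbit, and this never increases
    the total weight. Hence there are covers of weight at most 1 by words whose
    lengths all lie in a window of bounded size just above n. *)
Lemma growth_of_weighted_cover rho lam (W : seq (seq X)) :
  0 <= lam -> all (fun w => 0 < size w)%N W ->
  weight lam W <= 1 -> (forall y, has (follows rho ^~ y) W) ->
  growth rho lam.
Proof.
move=> lam0 /allP W0 W1 Wc.
pose L := \max_(w <- W) size w.
have WL v : v \in W -> (size v <= L)%N by move=> vW; exact: leq_bigmax_seq.
exists (expR (lam * L%:R)); first by rewrite -expR0 ler_expR mulr_ge0.
(* The words of length exactly n are extended by W, the longer ones kept. *)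
have : forall n, exists F : seq (seq X), [/\
    forall w, w \in F -> (n <= size w <= n + L)%N,
    weight lam F <= 1 & forall y, has (follows rho ^~ y) F].
  elim=> [|n [F [Fn F1 Fc]]].
    exists [:: [::]]; split => [w|//|//]; first by rewrite inE => /eqP ->.
    by rewrite /weight big_seq1 /= mulr0 oppr0 expR0.
  exists (flatten [seq if size w == n then [seq w ++ v | v <- W] else [:: w]
                  | w <- F]); split.
  - move=> w /flatten_mapP[u uF]; case: ifP => [/eqP un /mapP[v vW ->]|un].
      rewrite size_cat un -addn1 leq_add2l W0//= -addnA leq_add2l.
      exact: leq_trans (WL _ vW) (leq_addl _ _).
    rewrite inE => /eqP ->; have /andP[nu uL] := Fn _ uF.
    by rewrite ltn_neqAle eq_sym un nu/= addSn ltnW.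
  - exact: le_trans (weight_extend _ _ W1) F1.
  - move=> y; have /hasP[u uF uy] := Fc y; apply/hasP.
    case un : (size u == n); last first.
      by exists u => //; apply/flatten_mapP; exists u => //; rewrite un inE.
    have /hasP[v vW vy] := Wc (iter (size u) T y).
    exists (u ++ v); last by rewrite follows_cat uy.
    by apply/flatten_mapP; exists u => //; rewrite un map_f.
(* Truncation to length n costs the factor expR (lam * L): each word of F has
   weight at least expR (- lam * (n + L)), and these weights sum to at most 1. *)
move=> + n => /(_ n)[F [Fn F1 Fc]]; exists (map (take n) F); split.
- apply/allP => _ /mapP[w /Fn/andP[nw _] ->].
  by rewrite size_take_min (minn_idPl nw).
- rewrite size_map -expRD -mulrDr -natrD addnC.
  rewrite -[leRHS]mul1r -ler_pdivrMr ?expR_gt0// -expRN.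
  apply: le_trans F1; rewrite mulr_natl -iter_addr_0 -count_predT -big_const_seq.
  rewrite /weight big_seq [leRHS]big_seq ler_sum// => w /Fn/andP[_ wL].
  by rewrite ler_expR lerN2 ler_wpM2l// ler_nat.
- move=> y _.
  by rewrite has_map; apply: sub_has (Fc y) => w; exact: follows_take.
Qed.

End Cylinders.

Lemma finite_net (R : realType) (X : metricType R) : compact [set: X] ->
  forall delta : R, 0 < delta ->
  exists cs : seq X, forall y, exists2 c, c \in cs & mdist c y < delta.
Proof.
move=> cX d d0.
have [|y|cs csX] := compact_finite_subcover
  (f := fun c => [set y | mdist c y < d]) cX.
- move=> c; rewrite (_ : [set y | _] = [set y | follows id d [:: c] y]).
    by apply: open_follows => x; exact: cvg_id.
  by apply/seteqP; split => y /=; rewrite andbT.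
- by exists y; rewrite /= mdistxx.
- by exists cs.
Qed.

Section Encoding.
Context {R : realType} {X : metricType R}.
Variable T : X -> X.

Lemma covered_exists_in (I : eqType) rho (cs : seq I) (S : I -> set X) n k :
  (forall c, covered T rho (S c) n k) ->
  covered T rho [set y | exists2 c, c \in cs & S c y] n ((size cs)%:R * k).
Proof.
move=> Sk; elim: cs => [|c cs IH].
  by rewrite mul0r; apply: covered_le (covered0 T rho n) => // y [].
rewrite /= -natr1 mulrDl mul1r addrC.
apply: covered_le (coveredU (Sk c) IH) => //.
move=> y [c']; rewrite inE => /predU1P[->|c'cs] Sy; [by left|right].
by exists c'.
Qed.

Lemma growth_finite rho : compact [set: X] -> 0 < rho ->
  exists2 lam, 0 <= lam & growth T rho lam.
Proof.
move=> cX rho0; have [cs csX] := finite_net cX rho0.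
have c1 : covered T rho setT 1 (size cs).+1%:R.
  exists [seq [:: c] | c <- cs]; split.
  - by apply/allP => _ /mapP[c _ ->].
  - by rewrite size_map ler_nat.
  - move=> y _; have [c ccs cy] := csX y; apply/hasP.
    by exists [:: c]; [exact: map_f|rewrite /= cy].
have ln0 : 0 <= ln (size cs).+1%:R :> R by rewrite ln_ge0// ler1n.
exists (ln (size cs).+1%:R) => //; exists 1 => // n; rewrite mul1r.
rewrite expRM_natr lnK ?posrE//.
elim: n => [|n IH]; first exact: coveredT0.
by rewrite exprS; apply: covered_le (covered_cat c1 IH).
Qed.

Lemma weight_covered rho lam S n k : covered T rho S n k ->
  exists W : seq (seq X), [/\ all (fun w => size w == n) W,
    weight lam W <= k * expR (- (lam * n%:R))
    & forall y, S y -> has (fun w => follows T rho w y) W].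
Proof.
move=> [W [Wn Wk WS]]; exists W; split => //.
have -> : weight lam W = (size W)%:R * expR (- (lam * n%:R)).
  rewrite mulr_natl -iter_addr_0 -count_predT -big_const_seq /weight.
  by rewrite big_seq [RHS]big_seq; apply: eq_bigr => w /(allP Wn)/eqP ->.
by rewrite ler_wpM2r ?expR_ge0.
Qed.

(** Countable stability: pieces W N with summable weights may be treated
    separately, without uniformity in N. This is what plain covering numbers
    lack, and it is the reason for using weights. *)
Lemma growth_of_countable_cover rho lam (W : nat -> seq (seq X)) :
  compact [set: X] -> continuous T -> 0 <= lam ->
  (forall N, all (fun w => 0 < size w)%N (W N)) ->
  (forall N, weight lam (W N) <= 2 ^- N.+1) ->
  (forall y, exists N, has (fun w => follows T rho w y) (W N)) ->
  growth T rho lam.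
Proof.
move=> cX cT lam0 Wpos Wlam Wcov.
have [N|y|D DX] := compact_finite_subcover
    (f := fun N => \bigcup_(w in [set` W N]) [set y | follows T rho w y]) cX.
- by apply: bigcup_open => w _; exact: open_follows.
- by have [N /hasP[w wW wy]] := Wcov y; exists N; exists w.
pose M := (\max_(N <- D) N).+1.
apply: (growth_of_weighted_cover (W := flatten [seq W N | N <- iota 0 M])) => //.
- by apply/allP => w /flatten_mapP[N _]; exact: (allP (Wpos N)).
- apply: (@le_trans _ _ (1 - 2 ^- M)); last by rewrite gerBl invr_ge0 exprn_ge0.
  rewrite /weight big_flatten big_map.
  elim: M => [|M IH]; first by rewrite big_nil expr0 invr1 subrr.
  rewrite -addn1 iotaD big_cat big_seq1 /= add0n addn1.
  apply: le_trans (lerD IH (Wlam M)) _.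
  rewrite le_eqVlt; apply/orP; left; apply/eqP.
  by rewrite exprS invfM; field; rewrite expf_neq0.
- move=> y; have [N ND [w /= wW wy]] := DX y.
  have wM : w \in flatten [seq W N | N <- iota 0 M].
    apply/flatten_mapP; exists N => //; rewrite mem_iota /= add0n ltnS.
    exact: leq_bigmax_seq.
  by apply/hasP; exists w.
Qed.

(** * Encoding orbits that are often close to a given orbit *)

(** Uniform equicontinuity of finitely many iterates, by Heine-Cantor for T. *)
Lemma uniform_shadowing (rho : R) m : compact [set: X] -> continuous T ->
  0 < rho -> exists2 eps : R, 0 < eps & forall y z, mdist y z < eps ->
    forall j, (j < m)%N -> mdist (iter j T y) (iter j T z) < rho.
Proof.
move=> cX cT rho0; elim: m => [|m [e e0 IH]]; first by exists 1.
have : \forall d \near 0^'+, [set: X] `<=`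
    (fun y => forall z, mdist y z < d -> mdist (T y) (T z) < e).
  apply: (compact_near_coveringP _).1 => // x _.
  have e20 : 0 < e / 2 by rewrite divr_gt0.
  have [d /= d0 dT] := (metricType_numDomainType.nbhs_mdistP _ _).1
    (metricType_numDomainType.cvgr_dist_lt (cT x) e20).
  have d20 : 0 < d / 2 by rewrite divr_gt0.
  exists ([set y | mdist x y < d / 2], [set r | r < d / 2]).
    split => /=; last exact: nbhs_right_lt.
    by rewrite -ballEmdist; exact: nbhsx_ballx.
  move=> [y r] /= [xy rd] z yz.
  rewrite [ltRHS]splitr (le_lt_trans (metric_triangle _ (T x) _))//.
  have d2d : d / 2 < d by rewrite ltr_pdivrMr// ltr_pMr// ltr1n.
  rewrite ltrD//; first by rewrite metric_sym; exact/dT/(lt_trans xy).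
  apply: dT => /=; rewrite (le_lt_trans (metric_triangle _ y _))//.
  by rewrite [ltRHS]splitr ltrD// (lt_trans yz).
move=> [d /= d0 dP].
have d20 : 0 < d / 2 by rewrite divr_gt0.
have {}dP y z : mdist y z < d / 2 -> mdist (T y) (T z) < e.
  apply: (dP (d / 2)) => //=.
  by rewrite sub0r normrN gtr0_norm// ltr_pdivrMr// ltr_pMr// ltr1n.
exists (Num.min rho (d / 2)); first by rewrite lt_min rho0.
move=> y z; rewrite lt_min => /andP[yz1 yz2] [|j] jm //.
by rewrite !iterSr IH//; exact: dP.
Qed.

(** The point y is the position at time t, whereas c is a starting point at time 0:
    a block can then be removed from the window by moving y and keeping c. *)
Definition bad_times (A : pred nat) (c : X) (eps : R) t l (y : X) : nat :=
  count (fun j => A (t + j)%N && (eps <= mdist (iter (t + j) T c) (iter j T y)))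
    (iota 0 l).

Definition free_times (A : pred nat) t l : nat :=
  count (fun j => ~~ A (t + j)%N) (iota 0 l).

Lemma bad_timesD A c eps t m l y : bad_times A c eps t (m + l) y =
  (bad_times A c eps t m y + bad_times A c eps (t + m) l (iter m T y))%N.
Proof.
rewrite /bad_times count_iotaD; congr addn; apply: eq_count => j.
by rewrite addnA -iterD (addnC j).
Qed.

Lemma free_timesD A t m l :
  free_times A t (m + l) = (free_times A t m + free_times A (t + m) l)%N.
Proof.
rewrite /free_times count_iotaD; congr addn; apply: eq_count => j.
by rewrite addnA.
Qed.

(** The counting argument. Points that stay close to the orbit of c at most times
    of A are encoded by cutting the window of l times, starting at time t, into
    blocks: a maximal gap of A, which costs C * expR (lam * length), followed by
    a block of m steps starting at a time in A. If that time is good, closeness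
    at its start forces the next m steps to follow the orbit of c, so the block
    costs nothing; otherwise it costs K = C * expR (lam * m). Only the times
    outside A contribute to the exponent lam, however they are scattered, since
    there is at most one gap per m steps. The factor C * K in front pays for the
    last gap and for the last block, which may be shorter than m. *)
Lemma covered_few_bad_times rho lam eta eps C m (A : pred nat) (c : X) :
  0 <= lam -> 0 <= eta -> 1 <= C ->
  (forall n, covered T rho setT n (C * expR (lam * n%:R))) ->
  (0 < m)%N -> 2 * C <= expR (eta * m%:R) ->
  (forall y z, mdist y z < eps ->
    forall j, (j < m)%N -> mdist (iter j T y) (iter j T z) < rho) ->
  forall l t b, covered T rho [set y | (bad_times A c eps t l y <= b)%N] l
    (C * (C * expR (lam * m%:R)) ^+ b.+1 *
     expR (eta * l%:R) * expR (lam * (free_times A t l)%:R)).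
Proof.
move=> lam0 eta0 C1 Cov m0 mC shadow.
set K := C * expR (lam * m%:R).
have C0 : 0 < C by exact: lt_le_trans C1.
have E1 a n : 0 <= a -> 1 <= expR (a * n%:R) :> R.
  by move=> a0; rewrite -expR0 ler_expR mulr_ge0.
have K1 : 1 <= K by rewrite /K mulr_ege1// E1.
elim/ltn_ind => l IH t b.
pose s := find (fun j => A (t + j)%N) (iota 0 l).
have sl : (s <= l)%N.
  by have := find_size (fun j => A (t + j)%N) (iota 0 l); rewrite size_iota.
have free_s : free_times A t s = s.
  rewrite /free_times -[RHS](size_iota 0 s); apply/eqP; rewrite -all_count.
  apply/allP => j; rewrite mem_iota /= add0n => js.
  have := before_find 0%N js; rewrite nth_iota ?(leq_trans js)// add0n => ->.
  by [].
(* s is the length of the initial gap of A; a window that stops within m steps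
   after this gap needs only the two general covers. *)
case: (leqP l (s + m)) => lsm.
  have := covered_cat (Cov s) (Cov (l - s)%N).
  rewrite subnKC//; apply: covered_le => //.
  have fl : (s <= free_times A t l)%N.
    by rewrite -(subnKC sl) free_timesD free_s leq_addr.
  rewrite exprS (_ : C * (K * _) * _ * _ = C * expR (lam * (free_times A t l)%:R)
    * K * (K ^+ b * expR (eta * l%:R))); last by ring.
  apply: (@le_trans _ _ (C * expR (lam * (free_times A t l)%:R) * K)).
    apply: ler_pM; rewrite ?mulr_ge0 ?expR_ge0 ?(ltW C0)//.
      by rewrite ler_pM2l// ler_expR ler_wpM2l// ler_nat.
    by rewrite ler_pM2l// ler_expR ler_wpM2l// ler_nat leq_subLR.
  rewrite ler_peMr ?mulr_ge0 ?expR_ge0 ?(ltW C0) ?(le_trans ler01 K1)//.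
  by rewrite mulr_ege1 ?exprn_ege1 ?E1.
have [l' def_l] : exists l', l = (s + (m + l'))%N.
  by exists (l - (s + m))%N; rewrite addnA subnKC// ltnW.
have l'l : (l' < l)%N.
  by rewrite def_l addnA -[ltnLHS]add0n ltn_add2r addn_gt0 m0 orbT.
have sltl : (s < l)%N by exact: leq_ltn_trans (leq_addr m s) lsm.
have Ats : A (t + s)%N.
  have := nth_find 0%N (a := fun j => A (t + j)%N) (s := iota 0 l).
  rewrite -/s nth_iota// add0n; apply.
  by rewrite has_find -/s size_iota.
pose c' := iter (t + s) T c.
pose B b := C * K ^+ b.+1 * expR (eta * l'%:R) *
  expR (lam * (free_times A (t + s + m) l')%:R).
have B0 b' : 0 <= B b'.
  by rewrite /B !mulr_ge0 ?exprn_ge0 ?expR_ge0// ?(ltW C0) ?(le_trans ler01 K1).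
have good : covered T rho [set z | mdist c' z < eps] m 1.
  exists [:: traject T c' m]; split => //=; first by rewrite size_traject eqxx.
  move=> y /= cy; rewrite orbF; apply: follows_traject.
  exact: shadow.
(* A block whose first time is bad is covered by K arbitrary words, and leaves
   at most b - 1 bad times for the rest. *)
have bad : covered T rho [set z | eps <= mdist c' z /\
    (bad_times A c eps (t + s) (m + l') z <= b)%N] (m + l') (B b).
  have bad1 z : eps <= mdist c' z -> (0 < bad_times A c eps (t + s) m z)%N.
    move=> cz; rewrite /bad_times -has_count; apply/hasP; exists 0%N.
      by rewrite mem_iota.
    by rewrite addn0 Ats.
  case: b => [|b].
    apply: covered_le (covered0 T rho (m + l')) => // z /= [/bad1 z1].
    by rewrite bad_timesD leqn0 addn_eq0 => /andP[/eqP z0]; rewrite z0 in z1.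
  have := covered_cat (Cov m) (IH _ l'l (t + s + m)%N b).
  apply: covered_le.
    move=> z /= [/bad1 z1 zb]; split => //=.
    rewrite -ltnS (leq_trans _ zb)// bad_timesD -add1n leq_add//.
  rewrite /B -/K (exprS _ b.+1) le_eqVlt; apply/orP; left; apply/eqP; ring.
have := covered_cat (Cov s) (coveredU
  (covered_cat good (IH _ l'l (t + s + m)%N b)) bad).
rewrite -def_l; apply: covered_le.
  move=> y /=; rewrite def_l bad_timesD => yb; split => //=.
  have {}yb := leq_trans (leq_addl _ _) yb.
  have [cy|cy] := ltP (mdist c' (iter s T y)) eps; [left|by right].
  split => //=; move: yb; rewrite bad_timesD.
  by apply: leq_trans; exact: leq_addl.
(* The factor 2 for the good/bad alternative and the factor C for the gap are
   both absorbed by expR (eta * m), once per block of length m. *)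
rewrite mul1r -/(B b) -mulr2n -[B b *+ 2]mulr_natl.
have -> : C * K ^+ b.+1 * expR (eta * l%:R) * expR (lam * (free_times A t l)%:R)
  = expR (eta * s%:R) * expR (lam * (free_times A (t + s) m)%:R) *
    (expR (eta * m%:R) * expR (lam * s%:R) * B b).
  rewrite def_l !free_timesD free_s /B !natrD !mulrDr !expRD; ring.
rewrite -[leLHS]mul1r; apply: ler_pM => //.
- by apply: mulr_ge0; apply: mulr_ge0; rewrite ?expR_ge0 ?(ltW C0)//; exact: B0.
- by rewrite mulr_ege1 ?E1.
rewrite mulrA (mulrAC C) (mulrC C) ler_wpM2r// ler_wpM2r ?expR_ge0//.
Qed.

End Encoding.

Section MeanEquicontinuity.
Context {R : realType} {X : metricType R}.
Variable T : X -> X.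

(** * Contraction of the growth rate *)

(** Markov's inequality, for the average over the k terms of the subsequence below n. *)
Lemma bad_times_markov a c eps n y : subsequence a ->
  exists2 k, count (fun j => j \in range a) (iota 0 n) = k &
    (bad_times T (fun j => j \in range a) c eps 0 n y)%:R * eps <=
      k%:R * mean_dist T a k c y.
Proof.
move=> amono; have [k ak] := subsequence_filter n amono.
exists k; first by rewrite -size_filter ak size_map size_iota.
have -> : bad_times T (fun j => j \in range a) c eps 0 n y =
    count (fun i => eps <= mdist (iter (a i) T c) (iter (a i) T y)) (iota 0 k).
  rewrite -[RHS](count_map a (fun j => eps <= mdist (iter j T c) (iter j T y))).
  rewrite -ak count_filter; apply: eq_count => j /=.
  by rewrite add0n andbC.
(* The prefactor k%:R^-1 of mean_dist is 0 at k = 0. *)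
have [->|k0] := eqVneq k 0%N; first by rewrite !mul0r.
rewrite /mean_dist mulrA divff ?pnatr_eq0// mul1r.
rewrite -(big_mkord xpredT (fun i => mdist (iter (a i) T c) (iter (a i) T y))).
rewrite /index_iota subn0; elim: (iota 0 k) => [|i s IH].
  by rewrite big_nil mul0r.
rewrite big_cons /= natrD mulrDl lerD//.
by have [h|h] := leP eps (mdist _ _); rewrite /= ?mul1r ?mul0r ?mdist_ge0.
Qed.

Lemma mean_equicontinuous_eventually a e : mean_equicontinuous T a -> 0 < e ->
  exists2 delta : R, 0 < delta & forall x y, mdist x y < delta ->
    exists N, forall n, (N <= n)%N -> mean_dist T a n x y < e.
Proof.
move=> meq /meq[d d0 H]; exists d => // x y /H/limn_esup_lt[N HN].
by exists N => n /HN; rewrite lte_fin.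
Qed.

End MeanEquicontinuity.

Section Contraction.
Context {R : realType} {X : metricType R}.
Variable T : X -> X.

(** The contraction of growth rates. The points of a small ball around c split
    into the countably many sets S N c on which the averages are small from N on.
    At a long window n in which A has density alpha, covered_few_bad_times covers
    S N c by about expR (lam * (1 - alpha) * n) words; taking n large with N makes
    the weights of these covers summable. *)
Lemma growth_contraction a alpha rho lam eta :
  compact [set: X] -> continuous T -> subsequence a ->
  mean_equicontinuous T a -> 0 < alpha ->
  (forall N, exists2 n, (N <= n)%N &
    alpha * n%:R <= (count (fun j => j \in range a) (iota 0 n))%:R) ->
  0 < rho -> 0 <= lam -> 0 < eta -> 0 <= lam * (1 - alpha) + 3 * eta ->
  growth T rho lam -> growth T rho (lam * (1 - alpha) + 3 * eta).
Proof.
move=> cX cT amono meq alpha0 dens rho0 lam0 eta0 lam'0 [C C1 Cov].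
set A := fun j => j \in range a in dens *.
have C0 : 0 < C by exact: lt_le_trans C1.
have [m m0 /(_ m (leqnn m)) mC] := exists_expR_ge (2 * C) eta0.
have [eps eps0 shadow] := uniform_shadowing m cX cT rho0.
pose K := C * expR (lam * m%:R).
have K1 : 1 <= K by rewrite mulr_ege1// -expR0 ler_expR mulr_ge0.
have K0 : 0 < K by exact: lt_le_trans K1.
have lnK0 : 0 <= ln K by exact: ln_ge0.
(* eps1 is chosen so that K ^+ (eps1 * n) <= expR (eta * n). *)
pose eps1 := eta / (ln K + 1).
have eps10 : 0 < eps1 by rewrite divr_gt0// ltr_wpDl.
have [delta delta0 close] :=
  mean_equicontinuous_eventually meq (mulr_gt0 eps0 eps10).
have [cs csX] := finite_net cX delta0.
pose S N c :=
  [set y | forall k, (N <= k)%N -> mean_dist T a k c y < eps * eps1].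
(* The sets S N c exhaust the delta-ball at c, and S N c is covered economically
   at one well-chosen length n, which may depend on N. *)
have WN N : exists W : seq (seq X), [/\ all (fun w => 0 < size w)%N W,
    weight (lam * (1 - alpha) + 3 * eta) W <= 2 ^- N.+1
    & forall y, (exists2 c, c \in cs & S N c y) ->
        has (fun w => follows T rho w y) W].
  have [n1 n10 n1P] := exists_expR_ge ((size cs)%:R * (C * K) * 2 ^+ N.+1) eta0.
  pose n2 := (Num.truncn (N%:R / alpha)).+1.
  have [n nn nA] := dens (n1 + n2)%N.
  have n1n : (n1 <= n)%N by rewrite (leq_trans _ nn)// leq_addr.
  have n0 : (0 < n)%N by exact: leq_trans n1n.
  have bigP := n1P _ n1n.
  have nN : N%:R <= alpha * n%:R.
    rewrite mulrC -ler_pdivrMr// ltW// (lt_le_trans (truncnS_gt _))// ler_nat.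
    by apply: leq_trans nn; rewrite leq_addl.
  have eps1n : 0 <= eps1 * n%:R by apply: mulr_ge0; rewrite // ltW.
  pose b := Num.truncn (eps1 * n%:R).
  have SB c : covered T rho (S N c) n
      (C * K ^+ b.+1 * expR (eta * n%:R) * expR (lam * (free_times A 0 n)%:R)).
    apply: covered_le (covered_few_bad_times A c lam0 (ltW eta0) C1 Cov m0 mC
      shadow n 0 b) => //.
    move=> y /= Sy; have [k kE kb] := bad_times_markov T c eps n y amono.
    rewrite -/A in kE kb.
    have Nk : (N <= k)%N by rewrite -(ler_nat R) -kE (le_trans nN).
    have kn : (k <= n)%N.
      by rewrite -kE (leq_trans (count_size _ _))// size_iota.
    rewrite /b truncn_ge_nat//.
    rewrite -(ler_pM2r eps0) (le_trans kb)//.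
    rewrite (_ : eps1 * _ * _ = n%:R * (eps * eps1)); last by ring.
    apply: ler_pM; rewrite ?ler_nat ?(ltW (Sy _ Nk))//.
    by rewrite mulr_ge0 ?invr_ge0// sumr_ge0// => i _; exact: mdist_ge0.
  have [W [Wn Ww Wc]] := weight_covered (lam * (1 - alpha) + 3 * eta)
    (covered_exists_in cs SB).
  exists W; split => //.
    by apply/allP => w /(allP Wn)/eqP ->.
  apply: le_trans Ww _.
  (* Three factors expR (eta * n) are available: for the bad times, for the
     block count, and for the summability in N. *)
  have Kb : K ^+ b <= expR (eta * n%:R).
    rewrite -{1}(lnK (x := K))// -expRM_natr ler_expR.
    have bn : b%:R <= eps1 * n%:R by rewrite truncn_le.
    apply: le_trans (ler_wpM2l lnK0 bn) _; rewrite mulrA ler_wpM2r//.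
    rewrite /eps1 mulrCA ger_pMr// ler_pdivrMr ?mul1r ?lerDl//.
    by rewrite ltr_wpDl.
  have ff : (free_times A 0 n)%:R <= (1 - alpha) * n%:R :> R.
    have := count_predC A (iota 0 n).
    rewrite size_iota => /(congr1 (fun k => k%:R : R)).
    rewrite natrD /free_times => nE; rewrite mulrBl mul1r.
    rewrite lerBrDr -{2}nE addrC lerD2r.
    exact: nA.
  have Ef : expR (lam * (free_times A 0 n)%:R) <=
      expR (lam * ((1 - alpha) * n%:R)).
    by rewrite ler_expR ler_wpM2l.
  apply: (@le_trans _ _ ((size cs)%:R * (C * (K * expR (eta * n%:R)) *
      expR (eta * n%:R) * expR (lam * ((1 - alpha) * n%:R))) *
      expR (- ((lam * (1 - alpha) + 3 * eta) * n%:R)))).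
    apply: ler_wpM2r; first exact: expR_ge0.
    apply: ler_wpM2l => //; apply: ler_pM => //.
    - by rewrite !mulr_ge0 ?exprn_ge0 ?expR_ge0 ?(ltW C0) ?(ltW K0).
    - apply: ler_wpM2r; first exact: expR_ge0.
      by apply: ler_wpM2l; rewrite ?(ltW C0)// exprS ler_wpM2l// ltW.
  rewrite (_ : - _ = - (eta * n%:R) + (- (eta * n%:R) + (- (eta * n%:R) +
     - (lam * ((1 - alpha) * n%:R))))); last by ring.
  rewrite !expRD !expRN.
  have E0 : expR (eta * n%:R) != 0 by rewrite gt_eqF ?expR_gt0.
  have F0 : expR (lam * ((1 - alpha) * n%:R)) != 0 by rewrite gt_eqF ?expR_gt0.
  rewrite [leLHS](_ : _ = (size cs)%:R * (C * K) / expR (eta * n%:R));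
    last first.
    by field; rewrite E0 F0.
  by rewrite ler_pdivrMr ?expR_gt0// ler_pdivlMl ?exprn_gt0// mulrC.
have [W WP] := choice WN.
apply: (growth_of_countable_cover (W := W)) => // [N|N|y].
- by have [] := WP N.
- by have [] := WP N.
- have [c ccs cy] := csX y; have [N NP] := close _ _ cy.
  by exists N; have [_ _] := WP N; apply; exists c.
Qed.

(** The infimum of the admissible growth rates is nonnegative and is not
    increased by the factor 1 - alpha / 2 < 1, hence it vanishes. *)
Lemma growth_arbitrarily_small a rho lam :
  compact [set: X] -> continuous T -> subsequence a ->
  mean_equicontinuous T a -> (0 < upper_density R (range a))%E ->
  0 < rho -> 0 < lam -> growth T rho lam.
Proof.
move=> cX cT amono meq /density_of_upper_density_gt0[alpha alpha0 dens].
move=> rho0 lam0.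
have alpha1 : alpha <= 1.
  have [n n0 nA] := dens 1%N.
  have n0' : 0 < n%:R :> R by rewrite ltr0n.
  rewrite -(ler_pM2r n0') mul1r (le_trans nA)// ler_nat.
  by rewrite (leq_trans (count_size _ _))// size_iota.
pose L := [set l | 0 <= l /\ growth T rho l].
have [l1 l10 l1L] := growth_finite T cX rho0.
have Lhas : has_inf L.
  by split; [exists l1|exists 0 => l []].
have infL0 : 0 <= inf L by apply: lb_le_inf => [|l []//]; exists l1.
have stepL l : L l -> 0 < l -> L (l * (1 - alpha / 2)).
  move=> [l0 lL] lpos.
  have e : l * (1 - alpha) + 3 * (l * alpha / 6) = l * (1 - alpha / 2).
    by field.
  have l'0 : 0 <= l * (1 - alpha / 2) by rewrite mulr_ge0//; lra.
  split=> //; rewrite -e.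
  apply: (growth_contraction cX cT amono meq alpha0 dens) => //.
  - by rewrite divr_gt0// mulr_gt0.
  - by rewrite e.
have : inf L <= 0.
  rewrite leNgt; apply/negP => infpos.
  have lo : inf L / (1 - alpha / 2) <= inf L.
    apply: lb_le_inf; first by exists l1.
    move=> l Ll; have lpos : 0 < l.
      by apply: lt_le_trans infpos _; apply: ge_inf => //; case: Lhas.
    rewrite ler_pdivrMr; last by lra.
    by apply: ge_inf; [case: Lhas|exact: stepL].
  move: lo; rewrite ler_pdivrMr; last by lra.
  nra.
move=> infL; have [l [l0 lL] ll] := inf_adherent lam0 Lhas.
by apply: growth_le lL; lra.
Qed.

End Contraction.

Section Entropy.
Context {R : realType} {X : metricType R}.
Variable T : X -> X.

(** * Entropy *)

(** Distinct points of a separated set lie in distinct cylinders. *)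
Lemma separated_card_growth e rho C lam n :
  rho + rho <= e -> 0 < rho ->
  covered T rho setT n (C * expR (lam * n%:R)) ->
  (separated_card T n e <= (C * expR (lam * n%:R))%:E)%E.
Proof.
move=> re rho0 [F [Fn Fc FT]].
apply: ge_ereal_sup => _ /= [E Esep <-]; rewrite lee_fin; apply: le_trans Fc.
rewrite ler_nat.
pose f y := find (fun w => follows T rho w y) F.
have fF y : (f y < size F)%N by rewrite -has_find FT.
have finj : {in E &, injective f}.
  move=> x y xE yE fxy; apply/eqP/negPn/negP => xy.
  have := Esep _ _ xE yE xy; apply/negP; rewrite -leNgt.
  have xf : follows T rho (nth [::] F (f x)) x.
    exact: (nth_find [::] (FT x _)).
  have yf : follows T rho (nth [::] F (f x)) y.
    by rewrite fxy; exact: (nth_find [::] (FT y _)).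
  rewrite /bowen_dist; apply: bigmax_le => [|i _]; first by lra.
  apply: le_trans re; apply/ltW/(follows_dist xf yf).
  by rewrite (eqP (allP Fn _ (mem_nth _ (fF x)))).
have -> : #|` E| = size (map f E) by rewrite size_map.
rewrite -(size_iota 0 (size F)); apply: uniq_leq_size.
  by rewrite map_inj_in_uniq ?fset_uniq.
by move=> _ /mapP[y _ ->]; rewrite mem_iota /= add0n.
Qed.

Lemma separated_card_ge1 n e : [set: X] !=set0 -> (1 <= separated_card T n e)%E.
Proof.
move=> [x0 _]; apply: ereal_sup_ubound; exists [fset x0]%fset; last first.
  by rewrite cardfs1.
by move=> x y /=; rewrite !inE => /eqP -> /eqP ->; rewrite eqxx.
Qed.

Lemma entropy_at_scale_eq0 e : [set: X] !=set0 -> 0 < e ->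
  (forall rho lam, 0 < rho -> 0 < lam -> growth T rho lam) ->
  entropy_at_scale T e = 0%E.
Proof.
move=> X0 e0 H; apply/eqP; rewrite eq_le; apply/andP; split; last first.
  apply: limf_esup_ge0 => [|n]; first exact: filter_not_empty.
  by rewrite mule_ge0 ?lne_ge0 ?separated_card_ge1// lee_fin invr_ge0.
apply/lee_addgt0Pr => lam lam0; rewrite add0e.
have e20 : 0 < e / 2 by rewrite divr_gt0.
have lam20 : 0 < lam / 2 by rewrite divr_gt0.
have [C C1 Cov] := H _ _ e20 lam20.
have C0 : 0 < C by exact: lt_le_trans C1.
pose N := (Num.truncn (ln C / (lam / 2))).+1.
apply: (@limn_esup_le _ _ _ N) => n Nn.
have n0 : 0 < n%:R :> R by rewrite ltr0n; apply: leq_trans Nn.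
have B0 : 0 < C * expR (lam / 2 * n%:R) by rewrite mulr_gt0 ?expR_gt0.
have sep : (lne (separated_card T n e) <= (ln C + lam / 2 * n%:R)%:E)%E.
  rewrite -(expRK (lam / 2 * n%:R)) -lnM ?posrE ?expR_gt0// -lne_EFin//.
  have s1 := separated_card_ge1 n e X0.
  rewrite lee_lne ?in_itv /= ?leey ?andbT ?lee_fin ?(ltW B0)//.
    by apply: separated_card_growth (Cov n) => //; rewrite -splitr.
  exact: le_trans s1.
apply: le_trans (lee_wpmul2l _ sep) _; first by rewrite lee_fin invr_ge0.
rewrite -EFinM lee_fin mulrC ler_pdivrMr// [in leRHS](splitr lam) mulrDl lerD2r.
rewrite mulrC -ler_pdivrMr// ltW// (lt_le_trans (truncnS_gt _))// ler_nat.
exact: Nn.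
Qed.

End Entropy.

Theorem corollary1p5 (R : realType) (X : metricType R) (T : X -> X) :
  topological_dynamical_system T ->
  (exists a : nat -> nat,
     [/\ subsequence a,
         (0 < upper_density R (range a))%E
       & mean_equicontinuous T a]) ->
  topological_entropy T = 0%E.
Proof.
move=> [X0 cX [cT _]] [a [amono aD meq]].
apply: cvg_lim => //; apply: cvg_near_cst.
near=> e; apply: entropy_at_scale_eq0 => // rho lam rho0 lam0.
exact: growth_arbitrarily_small meq aD rho0 lam0.
Unshelve. all: by end_near. Qed.
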